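(* Let $N$ be a positive integer and let $\{\pi(i); i=0,1,\dots,N\}$ be a probability distribution with $\min_{0\le i\le N}\pi(i)>0$. With $p_i$ and the coalescence time $T_{\rm C}$ of the monotone birth-and-death process constructed from $\pi$ as defined in the context, one has $$\mathsf{E}[T_{\rm C}]\le\theta N,$$ where $$\theta=\min\left\{\max_{0\le i\le N-1}\left(\frac{1}{p_i}\sum_{m=0}^{i}\frac{\pi(m)}{\pi(i)}\right),\ \max_{0\le i\le N-1}\left(\frac{1}{p_i}\sum_{m=i+1}^{N}\frac{\pi(m)}{\pi(i)}\right)\right\}.$$
   Context: Let $\gamma(i)=\pi(i)/\pi(i+1)$ for $0\le i\le N-1$. Define $p_0=\frac{1}{1+\gamma(0)}$, $p_i=\frac{1}{1+\max(\gamma(i),\gamma(i-1))}$ for $1\le i\le N-1$, $p_N=0$; and $q_0=0$, $q_1=\frac{\gamma(0)}{1+\gamma(0)}$, $q_i=\frac{\gamma(i-1)}{1+\max(\gamma(i-1),\gamma(i-2))}$ for $2\le i\le N$. Define $\phi:\{0,\dots,N\}\times(0,1)\to\{0,\dots,N\}$ by $\phi(i,u)=i+1$ if $u\in(1-p_i,1)$, $\phi(i,u)=i$ if $u\in[q_i,1-p_i]$, and $\phi(i,u)=i-1$ if $u\in(0,q_i)$. Let $U_1,U_2,\dots$ be i.i.d. random variables uniform on $(0,1)$. For each $k\in\{0,\dots,N\}$ set $X_0^{(k)}=k$ and $X_n^{(k)}=\phi(X_{n-1}^{(k)},U_n)$ for $n\ge1$ (the same $U_n$ are used for all $k$). The coalescence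 time is $T_{\rm C}=\inf\{n\ge1: X_n^{(0)}=X_n^{(1)}=\cdots=X_n^{(N)}\}$. *)

(* Defs.v *)
From mathcomp Require Import all_boot all_order all_algebra.
From mathcomp Require Import all_classical all_reals all_analysis.

Set Implicit Arguments.
Unset Strict Implicit.
Unset Printing Implicit Defensive.

Import Order.TTheory GRing.Theory Num.Theory.

Local Open Scope classical_set_scope.
Local Open Scope ring_scope.

Definition positive_distribution (R : realType) (N : nat)
    (pi_ : 'I_N.+1 -> R) : Prop :=
  (forall i, 0 < pi_ i) /\ \sum_i pi_ i = 1.

(* Meaningful for i < N only: [inord] is the identity on indices <= N. *)
Definition gamma (R : realType) (N : nat) (pi_ : 'I_N.+1 -> R) (i : nat) : R :=
  pi_ (inord i) / pi_ (inord i.+1).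

Definition up_prob (R : realType) (N : nat) (pi_ : 'I_N.+1 -> R) (i : nat) : R :=
  if (i < N)%N then
    match i with
    | 0 => 1 / (1 + gamma pi_ 0)
    | j.+1 => 1 / (1 + Num.max (gamma pi_ j.+1) (gamma pi_ j))
    end
  else 0.

Definition down_prob (R : realType) (N : nat) (pi_ : 'I_N.+1 -> R) (i : nat) : R :=
  match i with
  | 0 => 0
  | 1 => gamma pi_ 0 / (1 + gamma pi_ 0)
  | j.+2 => gamma pi_ j.+1 / (1 + Num.max (gamma pi_ j.+1) (gamma pi_ j))
  end.

(* The update function is only meant for u in (0,1); outside that interval it
   is extended by phi(i,u) = i. Since up_prob N = 0 and down_prob 0 = 0, the
   chain never tries to leave {0,...,N}, so [inord] never truncates. *)
Definition update (R : realType) (N : nat) (pi_ : 'I_N.+1 -> R)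
    (i : 'I_N.+1) (u : R) : 'I_N.+1 :=
  if 1 - up_prob pi_ i < u < 1 then inord i.+1
  else if 0 < u < down_prob pi_ i then inord i.-1
  else i.

(* u n is the (n+1)-st innovation, used to go from time n to time n+1. *)
Fixpoint chain (R : realType) (N : nat) (pi_ : 'I_N.+1 -> R)
    (u : nat -> R) (k : 'I_N.+1) (n : nat) : 'I_N.+1 :=
  if n is m.+1 then update pi_ (chain pi_ u k m) (u m) else k.

(* +oo when the chains never coalesce (ereal_inf set0 = +oo). *)
Definition coalescence_time (R : realType) (N : nat) (pi_ : 'I_N.+1 -> R)
    (u : nat -> R) : \bar R :=
  ereal_inf [set n%:R%:E | n in [set n : nat |
    (1 <= n)%N /\ forall k l, chain pi_ u k n = chain pi_ u l n]].

Definition mutually_independent (d : measure_display) (T : measurableType d)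
    (R : realType) (P : probability T R) (U : nat -> {RV P >-> R}) : Prop :=
  forall (s : seq nat) (B : nat -> set R),
    uniq s -> (forall n, measurable (B n)) ->
    (P (\bigcap_(n in [set` s]) (U n @^-1` B n)) =
     \prod_(n <- s) P (U n @^-1` B n))%E.

(* The endpoints are negligible, so the law on [0,1] is the law on (0,1). *)
Definition uniform01 (d : measure_display) (T : measurableType d)
    (R : realType) (P : probability T R) (X : {RV P >-> R}) : Prop :=
  forall A : set R, measurable A ->
    distribution P X A = uniform_prob (@ltr01 R) A.

(* All the terms are positive, so the default value 0 of the maxima plays no
   role when 0 < N. *)
Definition theta (R : realType) (N : nat) (pi_ : 'I_N.+1 -> R) : R :=
  Num.min
    (\big[Num.max/0]_(i < N.+1 | (i < N)%N)
       (1 / up_prob pi_ i * \sum_(m < N.+1 | (m <= i)%N) pi_ m / pi_ i))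
    (\big[Num.max/0]_(i < N.+1 | (i < N)%N)
       (1 / up_prob pi_ i * \sum_(m < N.+1 | (i < m)%N) pi_ m / pi_ i)).

(* Main.v *)
(* All the chains are read off the composition G_n of n i.i.d. random monotone
   maps of {0,...,N}, and coalescence means that G_n is constant, which persists.
   Pointwise T_C <= sum_n 1[G_n is not constant]. If G_n is monotone and not
   constant, the lowest chain is below N and the highest one is above 0.

   With S j = sum_(m <= j) pi m, detailed balance makes the function
     H i = sum_(i <= j < N) S j / (pi j * p j)
   (the mean time to climb from i to N) decrease on average by exactly 1 per step
   while the chain is below N. Setting f g = H (g 0) for g not constant and
   f g = 0 otherwise gives E f (G_(n+1)) + P (G_n is not constant) <= E f (G_n),
   and summing over n gives E T_C <= H 0 <= N * max_j (S j / (pi j * p j)).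
   The highest chain and the mean time to descend from N give the other bound. *)
Require Import Defs.
From mathcomp Require Import all_boot all_order all_algebra.
From mathcomp Require Import all_classical all_reals all_analysis.
From mathcomp Require Import measurable_realfun.

Set Implicit Arguments.
Unset Strict Implicit.
Unset Printing Implicit Defensive.

Import Order.TTheory GRing.Theory Num.Theory.

Local Open Scope classical_set_scope.
Local Open Scope ring_scope.

(** * Finite-valued random variables *)

Section FiniteValued.
Context (d : measure_display) (T : measurableType d) (R : realType).
Variable P : probability T R.

(* Unlike [ge0_le_integral], no measurability: the integral of a nonnegative
   function is a supremum over the simple functions below it. *)
Lemma ge0_le_integral_nonmeasurable (f g : T -> \bar R) :
  (forall w, 0 <= f w)%E -> (forall w, f w <= g w)%E ->
  (\int[P]_w f w <= \int[P]_w g w)%E.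
Proof.
move=> f0 fg; rewrite !ge0_integralTE//; last first.
  by move=> w; exact: le_trans (fg w).
by apply: ereal_sup_le => _ [h hf <-]; exists h => // w; exact: le_trans (fg w).
Qed.

Lemma total_probability (J : finType) (X : T -> J) (E : set T) :
  (forall j, measurable (X @^-1` [set j])) -> measurable E ->
  fine (P E) = \sum_j fine (P (E `&` X @^-1` [set j])).
Proof.
move=> mX mE; apply: EFin_inj; rewrite -sumEFin fineK ?fin_num_measure//.
rewrite [RHS](eq_bigr (fun j => P (E `&` X @^-1` [set j]))); last first.
  by move=> j _; rewrite fineK ?fin_num_measure//; exact: measurableI.
rewrite -[RHS]big_enum/= fsbig_seq ?enum_uniq//.
rewrite -measure_fin_bigcup//.
- congr (P _); apply/seteqP; split => [w Ew|w [j _ []//]].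
  by exists (X w) => //=; rewrite mem_enum.
- apply/trivIsetP => i j _ _ ij; apply/seteqP; split => // w [] [_ /= ->] [_].
  by move=> /= /eqP; rewrite (negPf ij).
- by move=> j _; exact: measurableI.
Qed.

Lemma measurable_pred_preimage (J : finType) (X : T -> J) (A : pred J) :
  (forall j, measurable (X @^-1` [set j])) -> measurable [set w | A (X w)].
Proof.
move=> mX.
rewrite (_ : mkset _ = \big[setU/set0]_(j <- enum A) (X @^-1` [set j])).
  exact: bigsetU_measurable.
rewrite -bigcup_seq; apply/seteqP; split => [w /= Aw|w [j /=]].
  by exists (X w) => //=; rewrite mem_enum.
by rewrite mem_enum => Aj ->.
Qed.

Lemma measurable_pair_preimage (J K : finType) (X : T -> J) (Y : T -> K) jk :
  (forall j, measurable (X @^-1` [set j])) ->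
  (forall k, measurable (Y @^-1` [set k])) ->
  measurable ((fun w => (X w, Y w)) @^-1` [set jk]).
Proof.
move=> mX mY; rewrite (_ : _ @^-1` _ = X @^-1` [set jk.1] `&` Y @^-1` [set jk.2]).
  exact: measurableI.
by case: jk => j k; apply/seteqP; split => [w /= [<- <-]|w /= [<- <-]].
Qed.

Lemma probability_pred (J : finType) (X : T -> J) (A : pred J) :
  (forall j, measurable (X @^-1` [set j])) ->
  fine (P [set w | A (X w)]) = \sum_(j | A j) fine (P (X @^-1` [set j])).
Proof.
move=> mX; rewrite (total_probability mX (measurable_pred_preimage A mX)).
rewrite [RHS]big_mkcond/=; apply: eq_bigr => j _; case: ifPn => Aj.
  by congr (fine (P _)); apply/seteqP; split => [w []//|w /= Xw]; rewrite Xw.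
rewrite (_ : _ `&` _ = set0) ?measure0//.
by apply/seteqP; split => // w /= [] + Xw; rewrite Xw (negPf Aj).
Qed.

Lemma measurable_RV_preimage (X : {RV P >-> R}) (B : set R) :
  measurable B -> measurable (X @^-1` B).
Proof. by move=> mB; rewrite -[_ @^-1` _]setTI; exact: measurable_funP. Qed.

End FiniteValued.

(** * Compositions of independent random maps *)

Section RandomMaps.
Context (R : realType) (S : finType) (phi : R -> {ffun S -> S}).
Hypothesis mphi : forall v, measurable (phi @^-1` [set v]).
Local Notation F := {ffun S -> S}.

(** The newest map acts last, so evaluating at [k] follows the forward chain from [k], and one
    innovation drives all starting points. *)
Fixpoint iter_map (u : nat -> R) (n : nat) : F :=
  if n is m.+1 then [ffun x => phi (u m) (iter_map u m x)] else [ffun x => x].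

Context (d : measure_display) (T : measurableType d) (P : probability T R).
Variable U : nat -> {RV P >-> R}.
Hypothesis indepU : mutually_independent U.
Hypothesis lawU : forall n (B : set R), measurable B ->
  P (U n @^-1` B) = P (U 0%N @^-1` B).

Local Notation G n := (fun w => iter_map (fun i => U i w) n).
Local Notation Pr A := (fine (P A)).
(** By [lawU] this is the law of each random map [phi (U n w)]; index 0 stands for all. *)
Definition map_law (v : F) : R := Pr (U 0%N @^-1` (phi @^-1` [set v])).

Lemma measurable_iter_map n g : measurable (G n @^-1` [set g]).
Proof.
elim: n g => [|n IH] g.
  rewrite /=; case: (eqVneq [ffun x => x] g) => [<-|gN].
    by rewrite (_ : _ @^-1` _ = setT) //; apply/seteqP; split.
  rewrite (_ : _ @^-1` _ = set0) //; apply/seteqP; split => // w /= /eqP.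
  by rewrite (negPf gN).
have -> : G n.+1 @^-1` [set g] =
    [set w | [ffun x => phi (U n w) (G n w x)] == g].
  by apply/seteqP; split => w /= /eqP.
apply: (measurable_pred_preimage
  (X := fun w => (G n w, phi (U n w))) (fun p : F * F => [ffun x => p.2 (p.1 x)] == g)).
move=> p; apply: measurable_pair_preimage => // v.
exact: (measurable_RV_preimage (U n) (mphi v)).
Qed.

Lemma measurable_iter_map_pair n p :
  measurable ((fun w => (G n w, phi (U n w))) @^-1` [set p]).
Proof.
apply: measurable_pair_preimage => v; first exact: measurable_iter_map.
exact: (measurable_RV_preimage (U n) (mphi v)).
Qed.

(** [G n] is built from the innovations of index below [n], hence is independent of those of index
    at least [n]. The list [s] is left general for the induction: splitting [G n.+1] according to
    the pair [(G n, phi (U n))] adds the index [n] to it. *)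
Lemma iter_map_indep n g (s : seq nat) (B : nat -> set R) :
  uniq s -> all (leq n) s -> (forall i, measurable (B i)) ->
  Pr (G n @^-1` [set g] `&` \bigcap_(i in [set` s]) (U i @^-1` B i)) =
  Pr (G n @^-1` [set g]) * \prod_(i <- s) Pr (U i @^-1` B i).
Proof.
elim: n g s B => [|n IH] g s B us ns mB.
  have -> : \prod_(i <- s) Pr (U i @^-1` B i) =
      Pr (\bigcap_(i in [set` s]) (U i @^-1` B i)).
    rewrite indepU//; elim: (s) => [|i r IHr]; first by rewrite !big_nil.
    rewrite !big_cons IHr fineM//.
      by rewrite fin_num_measure//; exact: measurable_RV_preimage.
    by apply: prode_fin_num => j _; rewrite fin_num_measure//; exact: measurable_RV_preimage.
  have [gE|gN] := eqVneq [ffun x => x] g.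
    rewrite (_ : G 0%N @^-1` _ = setT); last by apply/seteqP; split.
    by rewrite setTI probability_setT mul1r.
  rewrite (_ : G 0%N @^-1` _ = set0); last first.
    by apply/seteqP; split => // w /= /eqP; rewrite (negPf gN).
  by rewrite set0I measure0 mul0r.
have nNs : n \notin s by apply/negP => /(allP ns); rewrite ltnn.
have mI C : (forall i : nat, measurable (C i)) ->
    measurable (\bigcap_(i in [set` s]) (U i @^-1` C i)).
  by move=> mC; apply: fin_bigcap_measurable => // i _; exact: measurable_RV_preimage.
pose X w := (G n w, phi (U n w)).
have mX : forall p, measurable (X @^-1` [set p]) := measurable_iter_map_pair n.
rewrite (total_probability P mX (measurableI _ _ (measurable_iter_map n.+1 g) (mI _ mB))).
rewrite (total_probability P mX (measurable_iter_map n.+1 g)) mulr_suml.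
apply: eq_bigr => -[g' v] _.
have [gE|gN] := eqVneq [ffun x => v (g' x)] g; last first.
  have GX : G n.+1 @^-1` [set g] `&` X @^-1` [set (g', v)] = set0.
    apply/seteqP; split => // w [gE [g'E vE]].
    by case/eqP: gN; rewrite -gE -g'E -vE.
  by rewrite setIAC GX set0I measure0 mul0r.
have mB' i : measurable (if i == n then phi @^-1` [set v] else B i).
  by case: ifP => _; [exact: mphi|exact: mB].
have s'P : all (leq n) s.
  by apply/allP => i /(allP ns) /ltnW.
have GX : G n.+1 @^-1` [set g] `&` X @^-1` [set (g', v)] =
    G n @^-1` [set g'] `&` U n @^-1` (phi @^-1` [set v]).
  apply/seteqP; split => w /=; first by case=> _ [-> ->].
  by move=> [g'E vE]; rewrite /X g'E vE; split.
rewrite setIAC GX.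
(* The hypothesis is used twice: for [n :: s], and for [n] alone to factor the event that remains on
   the right-hand side. *)
have := IH g' (n :: s) (fun i => if i == n then phi @^-1` [set v] else B i).
rewrite /= nNs us leqnn s'P => /(_ erefl erefl mB').
have := IH g' [:: n] (fun i => if i == n then phi @^-1` [set v] else B i).
rewrite /= leqnn => /(_ erefl erefl mB').
rewrite set_cons1 bigcap_set1 eqxx big_seq1 eqxx => ->.
rewrite big_cons eqxx mulrA => IHs.
rewrite -setIA.
transitivity (Pr (G n @^-1` [set g'] `&` \bigcap_(i in [set` n :: s])
    (U i @^-1` (if i == n then phi @^-1` [set v] else B i)))).
  congr (fine (P _)); congr (_ `&` _).
  apply/seteqP; split => [w [vE sE] i /=|w H].
    rewrite inE => /predU1P[->|]; first by rewrite eqxx.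
    by case: ifPn => [/eqP ->//|_ /sE].
  split; first by have := H n; rewrite /= eqxx inE eqxx; exact.
  move=> i /= si; have := H i; rewrite /= inE si orbT.
  by case: ifPn => [/eqP iE|_]; [move: nNs; rewrite -iE si|exact].
rewrite IHs; congr (_ * _); apply: eq_big_seq => i si.
by case: ifPn => // /eqP iE; move: nNs; rewrite -iE si.
Qed.

(** Markov property: [G n] is independent of the next map, so averaging [f] over [G n.+1] amounts to
    averaging over the next map first, with [G n] fixed. *)
Lemma iter_map_lawS n (f : F -> R) :
  \sum_g Pr (G n.+1 @^-1` [set g]) * f g =
  \sum_g Pr (G n @^-1` [set g]) *
    \sum_v map_law v * f [ffun x => v (g x)].
Proof.
pose X w := (G n w, phi (U n w)).
have mX : forall p, measurable (X @^-1` [set p]) := measurable_iter_map_pair n.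
transitivity (\sum_g \sum_(p : F * F | [ffun x => p.2 (p.1 x)] == g)
    Pr (G n @^-1` [set p.1]) * map_law p.2 * f [ffun x => p.2 (p.1 x)]).
  apply: eq_bigr => g _.
  have -> : G n.+1 @^-1` [set g] =
      [set w | [ffun x => (X w).2 ((X w).1 x)] == g].
    by apply/seteqP; split => w /= /eqP.
  rewrite (probability_pred P (fun p : F * F => [ffun x => p.2 (p.1 x)] == g) mX).
  rewrite mulr_suml; apply: eq_bigr => -[g' v] /= /eqP ->; congr (_ * _).
  have := @iter_map_indep n g' [:: n] (fun=> phi @^-1` [set v]).
  rewrite /= leqnn => /(_ erefl erefl (fun=> mphi _)).
  rewrite set_cons1 bigcap_set1 big_seq1 lawU ?mphi// => <-.
  by congr (fine (P _)); apply/seteqP; split => w /= [<- <-].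
(* Each pair of maps contributes to exactly one [g], its composition. *)
rewrite [LHS](exchange_big_dep predT)//=.
under [RHS]eq_bigr => g _ do rewrite mulr_sumr.
rewrite pair_big/=; apply: eq_bigr => -[g v] _ /=.
by rewrite (big_pred1 [ffun x => v (g x)]) ?mulrA// => g'; rewrite eq_sym.
Qed.

(** Telescoping: the partial sum up to [M] plus the mean of [f (G M)] never increases with [M], and
    starts at the value of [f] at the identity. The drift is required only at compositions
    [iter_map u n], because only these are known to be monotone in the application. *)
Lemma lyapunov_partial_sum (f : F -> R) (A : pred F) (M : nat) :
  (forall g, 0 <= f g) ->
  (forall u n, \sum_v map_law v * f [ffun x => v (iter_map u n x)] <=
     f (iter_map u n) - (A (iter_map u n))%:R) ->
  \sum_(n < M) Pr [set w | A (G n w)] <= f [ffun x => x].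
Proof.
move=> f0 fA.
suff : \sum_(n < M) Pr [set w | A (G n w)] +
    \sum_g Pr (G M @^-1` [set g]) * f g <= f [ffun x => x].
  apply: le_trans; rewrite lerDl sumr_ge0// => g _.
  by rewrite mulr_ge0// fine_ge0.
elim: M => [|M IH].
  rewrite big_ord0 add0r (bigD1 [ffun x => x])//= big1 ?addr0; last first.
    move=> g gN; rewrite (_ : _ @^-1` _ = set0) ?measure0 ?mul0r//.
    by apply/seteqP; split => // w /= gE; rewrite gE eqxx in gN.
  rewrite (_ : _ @^-1` _ = setT); last by apply/seteqP; split.
  by rewrite probability_setT mul1r.
apply: le_trans IH; rewrite big_ord_recr/= -addrA lerD2l.
rewrite iter_map_lawS (probability_pred P A (@measurable_iter_map M)).
rewrite big_mkcond -big_split/=; apply: ler_sum => g _.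
have [[w gE]|gN] := pselect (exists w, G M w = g).
  have -> : (if A g then Pr (G M @^-1` [set g]) else 0) =
      Pr (G M @^-1` [set g]) * (A g)%:R by case: (A g); rewrite ?mulr1 ?mulr0.
  rewrite -mulrDr ler_wpM2l ?fine_ge0// -lerBrDl -gE; exact: fA.
rewrite (_ : _ @^-1` _ = set0) ?measure0; last first.
  by apply/seteqP; split => // w /= gE; apply: gN; exists w.
by rewrite /= if_same !mul0r addr0.
Qed.

(** Integral and series of nonnegative terms are exchanged; the uniform bound on the partial sums
    then passes to the limit. *)
Lemma integral_count_le (f : F -> R) (A : pred F) :
  (forall g, 0 <= f g) ->
  (forall u n, \sum_v map_law v * f [ffun x => v (iter_map u n x)] <=
     f (iter_map u n) - (A (iter_map u n))%:R) ->
  (\int[P]_w \sum_(n <oo) (A (G n w))%:R%:E <= (f [ffun x => x])%:E)%E.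
Proof.
move=> f0 fA.
have mA n := measurable_pred_preimage A (measurable_iter_map n).
have AE n : (fun w => (A (G n w))%:R%:E) =
    (fun w => (\1_[set w | A (G n w)] w)%:E) :> (T -> \bar R).
  by apply/funext => w; rewrite indicE; congr (_%:R%:E); rewrite mem_setE.
rewrite integral_nneseries//; last first.
  by move=> n; rewrite AE; apply/measurable_EFinP; exact: measurable_indic.
have int0 n : (0 <= \int[P]_w (A (G n w))%:R%:E)%E.
  by apply: integral_ge0 => w _; rewrite lee_fin ler0n.
apply: lime_le; first by apply: is_cvg_nneseries => n _ _; exact: int0.
apply: nearW => M; rewrite big_mkord.
apply: (@le_trans _ _ (\sum_(n < M) Pr [set w | A (G n w)])%:E); last first.
  by rewrite lee_fin; exact: lyapunov_partial_sum.
rewrite -sumEFin; apply: lee_sum => n _.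
by rewrite AE integral_indic// setIT fineK// fin_num_measure.
Qed.

End RandomMaps.

(** * The monotone update rule *)

Section UpdateRule.
Context (R : realType) (N : nat) (pi_ : 'I_N.+1 -> R).
Hypothesis pi_gt0 : forall i, 0 < pi_ i.
Local Notation p := (up_prob pi_).
Local Notation q := (down_prob pi_).
Local Notation ga := (gamma pi_).

(** * Bounds on the jump probabilities *)

Lemma gamma_gt0 i : 0 < ga i.
Proof. by rewrite divr_gt0. Qed.

Lemma up_prob_gt0 i : (i < N)%N -> 0 < p i.
Proof.
move=> iN; rewrite /up_prob iN; case: i iN => [|i] _.
  by rewrite divr_gt0// addr_gt0// gamma_gt0.
by rewrite divr_gt0// addr_gt0// lt_max gamma_gt0.
Qed.

Lemma up_prob_ge0 i : 0 <= p i.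
Proof.
case: (ltnP i N) => iN; first exact/ltW/up_prob_gt0.
by rewrite /up_prob ltnNge iN.
Qed.

Lemma up_probN : p N = 0.
Proof. by rewrite /up_prob ltnn. Qed.

(** The probabilities of going up from [i] and down from [i.+1] share one denominator; this is
    detailed balance across the edge between them. *)
Lemma down_probS i : (i < N)%N -> q i.+1 = ga i * p i.
Proof. by move=> iN; rewrite /up_prob iN; case: i iN => [|i] _ /=; rewrite mul1r. Qed.

Lemma down_prob_ge0 i : 0 <= q i.
Proof.
case: i => [|[|i]] //=; apply: divr_ge0; rewrite ?ltW ?gamma_gt0//.
  by rewrite addr_gt0// gamma_gt0.
by rewrite addr_gt0// lt_max gamma_gt0.
Qed.

(** A maximum dominates both of its arguments. Keeping [ga i] each time bounds [p i], [p i.+1] and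
    [q i.+1] by fractions over [1 + ga i], which can then be added. *)
Lemma up_prob_le i : p i <= 1 / (1 + ga i).
Proof.
rewrite /up_prob; case: ifP => _; last by rewrite divr_ge0// addr_ge0// ltW// gamma_gt0.
case: i => [|i]//; rewrite !div1r lef_pV2 ?posrE ?addr_gt0 ?lt_max ?gamma_gt0//.
by rewrite lerD2l le_max lexx.
Qed.

Lemma up_probS_le i : p i.+1 <= 1 / (1 + ga i).
Proof.
rewrite /up_prob; case: ifP => _; last by rewrite divr_ge0// addr_ge0// ltW// gamma_gt0.
rewrite !div1r lef_pV2 ?posrE ?addr_gt0 ?lt_max ?gamma_gt0//.
by rewrite lerD2l le_max lexx orbT.
Qed.

Lemma down_probS_le i : q i.+1 <= ga i / (1 + ga i).
Proof.
case: i => [|i]//=; rewrite ler_wpM2l ?(ltW (gamma_gt0 _))//.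
rewrite lef_pV2 ?posrE ?addr_gt0 ?lt_max ?gamma_gt0//.
by rewrite lerD2l le_max lexx.
Qed.

Lemma gamma_split i : 1 / (1 + ga i) + ga i / (1 + ga i) = 1.
Proof. by rewrite -mulrDl divff// gt_eqF// addr_gt0// gamma_gt0. Qed.

(** Keeps neighbours from crossing: no [u] sends [i] up and [i.+1] down. *)
Lemma up_down_le1 i : p i + q i.+1 <= 1.
Proof. by rewrite -(gamma_split i) lerD// ?up_prob_le// down_probS_le. Qed.

(** Makes the up and down intervals of one state disjoint. *)
Lemma up_down_same_le1 i : p i + q i <= 1.
Proof.
case: i => [|i]; last by rewrite -(gamma_split i) lerD// ?up_probS_le// down_probS_le.
apply: le_trans (up_down_le1 0); rewrite lerD2l; exact: down_prob_ge0.
Qed.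

(** The new state is indexed as a natural number, so that a case analysis removes [inord] and
    supplies the range conditions. *)
Variant update_spec (i : 'I_N.+1) (u : R) : nat -> bool -> bool -> Type :=
| UpdateUp of 1 - p i < u < 1 & (i < N)%N : update_spec i u i.+1 true false
| UpdateDown of 0 < u < q i & u <= 1 - p i & (0 < i)%N :
    update_spec i u i.-1 false true
| UpdateStay of ~~ (1 - p i < u < 1) & ~~ (0 < u < q i) :
    update_spec i u i false false.

Lemma updateP (i : 'I_N.+1) (u : R) :
  update_spec i u (update pi_ i u) (1 - p i < u < 1) (0 < u < q i).
Proof.
rewrite /update; case: ifPn => [up|nup].
  have iN : (i < N)%N.
    rewrite ltn_neqAle -ltnS ltn_ord andbT; apply/eqP => iN.
    by move: up; rewrite iN up_probN subr0 => /andP[/lt_trans h /h]; rewrite ltxx.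
  have -> : (0 < u < q i) = false.
    apply/negP => /andP[_ uq]; have := up_down_same_le1 i.
    rewrite -lerBrDl leNgt; case/andP: up => + _ => /lt_trans/(_ uq) ->//.
  by rewrite inordK//; constructor.
case: ifPn => [dn|ndn]; last by constructor.
have i0 : (0 < i)%N.
  rewrite lt0n; apply/eqP => i0; move: dn; rewrite i0 /= => /andP[/lt_trans h /h].
  by rewrite ltxx.
have -> : nat_of_ord (inord i.-1 : 'I_N.+1) = i.-1.
  by rewrite inordK// (leq_ltn_trans (leq_pred _)).
constructor => //; case/andP: dn => u0 uq.
apply: le_trans (ltW uq) _; rewrite lerBrDl; exact: up_down_same_le1.
Qed.

(** Steps have size at most 1, so the order could fail only when the lower state goes up and the
    upper one goes down. *)
Lemma update_mono u : {homo (fun i => update pi_ i u) : i j / (i <= j)%N}.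
Proof.
move=> i j; rewrite leq_eqVlt => /predU1P[ij|ij].
  by have -> : i = j by exact: val_inj.
case: (updateP i u) => [upi iN|dni _ i0|_ _];
  case: (updateP j u) => [upj jN|dnj uj j0|_ _].
- by rewrite ltnS ltnW.
(* Neighbours are excluded by [up_down_le1]; states at distance at least 2 can at most meet. *)
- have [ijE|ijN] := eqVneq (j : nat) i.+1.
    exfalso; case/andP: dnj => _; rewrite ijE => uq.
    case/andP: upi => up _; have := lt_trans up uq.
    by rewrite ltNge lerBrDl up_down_le1.
  by move: ij ijN; case: (nat_of_ord j) => // k; rewrite ltnS leq_eqVlt => /predU1P[->|//]; rewrite eqxx.
- exact: ij.
- by rewrite (leq_trans (leq_pred _))// ltnW// ltnW.
- by rewrite -!subn1 leq_sub2r// ltnW.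
- by rewrite (leq_trans (leq_pred _))// ltnW.
- by rewrite ltnW// ltnW.
- by rewrite -ltnS prednK.
- exact: ltnW.
Qed.

Definition update_map (u : R) : {ffun 'I_N.+1 -> 'I_N.+1} :=
  [ffun i => update pi_ i u].

Lemma measurable_update_map v : measurable (update_map @^-1` [set v]).
Proof.
have mQ (Q : Prop) : measurable [set _ : R | Q].
  have [q|nq] := pselect Q.
    by rewrite (_ : mkset _ = setT)//; apply/seteqP; split.
  by rewrite (_ : mkset _ = set0)//; apply/seteqP; split.
rewrite (_ : _ @^-1` _ = \bigcap_(i in [set: 'I_N.+1]) [set u | update pi_ i u = v i]); last first.
  apply/seteqP; split => [u /= <- i _ /=|u H]; first by rewrite ffunE.
  by apply/ffunP => i; rewrite ffunE; exact: H.
apply: fin_bigcap_measurable => // i _.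
(* The conditions on [v i] do not involve [u]: each cuts out the empty set or the whole line. *)
rewrite (_ : mkset _ =
  (`]1 - p i, 1[ `&` [set _ | inord i.+1 = v i]) `|`
  ((~` `]1 - p i, 1[ `&` `]0, q i[ `&` [set _ | inord i.-1 = v i]) `|`
   (~` `]1 - p i, 1[ `&` ~` `]0, q i[ `&` [set _ | i = v i])))%classic.
  have mI (a b : R) : measurable `]a, b[%classic by exact: measurable_itv.
  by repeat first [apply: measurableU | apply: measurableI | apply: measurableC | exact: mQ | exact: mI].
apply/seteqP; split => u /=; rewrite /update !in_itv/=.
  case: ifPn => [_ ->|/negP nup]; first by left.
  case: ifPn => [dn <-|/negP ndn <-]; right; first by left.
  by right.
move=> [[-> //]|[[[/negP/negPf -> ->]]//|[[/negP/negPf -> /negP/negPf ->]//]]].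
Qed.

(** * Monotone compositions and coalescence *)

Local Notation G u n := (iter_map update_map u n).

Lemma iter_map_chain u n k : G u n k = chain pi_ u k n.
Proof. by elim: n => [|n IH] /=; rewrite ffunE// IH ffunE. Qed.

Lemma iter_map_mono u n : {homo G u n : i j / (i <= j)%N}.
Proof.
elim: n => [|n IH] i j ij /=; rewrite !ffunE//.
by apply: update_mono; exact: IH.
Qed.

Definition nonconstant (g : {ffun 'I_N.+1 -> 'I_N.+1}) : bool :=
  ~~ [forall k, forall l, g k == g l].

Lemma constantP (g : {ffun 'I_N.+1 -> 'I_N.+1}) :
  reflect (forall k l, g k = g l) (~~ nonconstant g).
Proof.
rewrite negbK; apply: (iffP forallP) => [H k l|H k].
  by have /forallP/(_ l)/eqP := H k.
by apply/forallP => l; rewrite (H k l).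
Qed.

(** By monotonicity every chain lies above the lowest one; once that one is at [N], all are. *)
Lemma nonconstant_ord0 u n : nonconstant (G u n) -> (G u n ord0 < N)%N.
Proof.
apply: contraTT; rewrite -leqNgt => N0; apply/constantP.
suff H k : nat_of_ord (G u n k) = N by move=> k l; apply: val_inj; rewrite /= !H.
apply/eqP; rewrite eqn_leq -ltnS ltn_ord/=; apply: leq_trans N0 _.
exact: iter_map_mono.
Qed.

Lemma nonconstant_ord_max u n : nonconstant (G u n) -> (0 < G u n ord_max)%N.
Proof.
apply: contraTT; rewrite -leqNgt => N0; apply/constantP.
suff H k : nat_of_ord (G u n k) = 0%N by move=> k l; apply: val_inj; rewrite /= !H.
apply/eqP; rewrite -leqn0; apply: leq_trans N0.
by apply: iter_map_mono; rewrite -ltnS ltn_ord.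
Qed.

(** If [m] is the first index with a constant map, the [m] earlier terms of the series are all 1. *)
Lemma coalescence_time_le_series u : (0 < N)%N ->
  (coalescence_time pi_ u <= \sum_(n <oo) (nonconstant (G u n))%:R%:E)%E.
Proof.
move=> N0; have sum_ge M : (forall n, (n < M)%N -> nonconstant (G u n)) ->
    (M%:R%:E <= \sum_(n <oo) (nonconstant (G u n))%:R%:E :> \bar R)%E.
  move=> H; apply: le_trans (nneseries_lim_ge M _); last first.
    by move=> n _ _; rewrite lee_fin ler0n.
  rewrite big_mkord (eq_bigr (fun=> 1%:E)); last by move=> i _; rewrite H.
  by rewrite sumEFin sumr_const card_ord.
(* Time 0 is excluded from [coalescence_time]; for positive [N] the identity is not constant, so the
   first constant map has a positive index. *)
have nc0 : nonconstant (G u 0).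
  rewrite /= -[nonconstant _]negbK; apply/constantP => /(_ ord0 ord_max).
  by rewrite !ffunE => /(congr1 val)/= N1; rewrite -N1 in N0.
have [ex|nex] := pselect (exists n, ~~ nonconstant (G u n)).
  case: (ex_minnP ex) => m mc mmin.
  apply: (@le_trans _ _ (m%:R%:E)); last first.
    by apply: sum_ge => n; apply: contraTT => /mmin; rewrite -leqNgt.
  apply: ereal_inf_lbound; exists m => //; split.
    by rewrite lt0n; apply: contraNneq mc => ->.
  by move=> k l; rewrite -!iter_map_chain; apply/constantP.
(* Without coalescence every term is 1 and the series diverges. *)
rewrite (_ : (\sum_(n <oo) _ = +oo)%E) ?leey//.
apply/eqyP => A A0; apply: (@le_trans _ _ (Num.bound A)%:R%:E).
  by rewrite lee_fin ltW// archi_boundP// ltW.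
apply: sum_ge => n _; apply: contra_notT nex => nc; by exists n.
Qed.

End UpdateRule.

Lemma uniform01_itv (d : measure_display) (T : measurableType d) (R : realType)
    (P : probability T R) (X : {RV P >-> R}) (a b : R) :
  uniform01 X -> 0 <= a -> a <= b -> b <= 1 ->
  fine (P (X @^-1` `]a, b[)) = b - a.
Proof.
move=> uX a0 ab b1.
have := uX `]a, b[%classic (measurable_itv _); rewrite /distribution /pushforward => ->.
rewrite /uniform_prob integral_uniform_pdf.
have ab01 : `]a, b[ `<=` `[0, 1].
  move=> x /=; rewrite !in_itv/= => /andP[ax xb].
  by rewrite (le_trans a0 (ltW ax)) (le_trans (ltW xb) b1).
rewrite setIidl// (eq_integral (fun=> 1%:E)); last first.
  move=> x; rewrite inE => /ab01/=; rewrite in_itv/= /uniform_pdf => ->.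
  by rewrite subr0 invr1.
rewrite integral_cst//= mul1e lebesgue_measure_itv/= lte_fin.
by move: ab; rewrite le_eqVlt => /predU1P[->|->]; rewrite ?ltxx ?subrr.
Qed.

(** * Drift and coalescence *)

Section Coalescence.
Context (R : realType) (N : nat) (pi_ : 'I_N.+1 -> R).
Hypothesis pi_gt0 : forall i, 0 < pi_ i.
Hypothesis N_gt0 : (0 < N)%N.
Local Notation p := (up_prob pi_).
Local Notation q := (down_prob pi_).
Context (d : measure_display) (T : measurableType d) (P : probability T R).
Variable U : nat -> {RV P >-> R}.
Hypothesis indepU : mutually_independent U.
Hypothesis uniformU : forall n, uniform01 (U n).
Local Notation law := (map_law (update_map pi_) U).

(** Generator of the chain at one site. The values of [H] beyond the ends are harmless, since [p N]
    and [q 0] vanish. *)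
Lemma update_map_generator (H : nat -> R) (i : 'I_N.+1) :
  \sum_v law v * H (v i) = H i + p i * (H i.+1 - H i) + q i * (H i.-1 - H i).
Proof.
pose X w := update_map pi_ (U 0%N w).
have mX v : measurable (X @^-1` [set v]).
  exact: (measurable_RV_preimage (U 0%N) (measurable_update_map pi_ v)).
have lawE (A : pred {ffun 'I_N.+1 -> 'I_N.+1}) :
    \sum_(v | A v) law v = fine (P [set w | A (X w)]).
  by rewrite (probability_pred P A mX).
have p1 : p i <= 1.
  by apply: le_trans (up_down_same_le1 pi_gt0 i); rewrite lerDl down_prob_ge0.
have q1 : q i <= 1.
  by apply: le_trans (up_down_same_le1 pi_gt0 i); rewrite lerDr up_prob_ge0.
have law1 : \sum_v law v = 1.
  by rewrite lawE (_ : mkset _ = setT) ?probability_setT//; apply/seteqP; split.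
have lawp : \sum_(v : {ffun 'I_N.+1 -> 'I_N.+1} | v i == i.+1 :> nat) law v = p i.
  rewrite lawE -[RHS](subKr 1) -(@uniform01_itv _ _ _ _ (U 0%N) (1 - p i) 1)//.
  - congr (fine (P _)); apply/seteqP; split => w /=; rewrite in_itv/= ffunE.
      case: (updateP pi_gt0 i (U 0%N w)) => // _ _; last by rewrite ltn_eqF.
      by move=> _; rewrite ltn_eqF// ltnS leq_pred.
    by case: (updateP pi_gt0 i (U 0%N w)).
  - by rewrite subr_ge0.
  - by rewrite gerBl up_prob_ge0.
(* Testing [(v i).+1] against [i] rather than [v i] against [i.-1] keeps staying at 0 from counting
   as a step down. *)
have lawq : \sum_(v : {ffun 'I_N.+1 -> 'I_N.+1} | (v i).+1 == i :> nat) law v = q i.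
  rewrite lawE -[RHS]subr0 -(@uniform01_itv _ _ _ _ (U 0%N) 0 (q i))//; last first.
    exact: down_prob_ge0.
  congr (fine (P _)); apply/seteqP; split => w /=; rewrite in_itv/= ffunE.
    case: (updateP pi_gt0 i (U 0%N w)) => // _ _; last by rewrite gtn_eqF.
    by rewrite gtn_eqF// ltnW.
  by case: (updateP pi_gt0 i (U 0%N w)) => // _ _ i0 _; rewrite prednK.
transitivity (\sum_v (law v * H i + (if v i == i.+1 :> nat then law v else 0) * (H i.+1 - H i)
    + (if (v i).+1 == i :> nat then law v else 0) * (H i.-1 - H i))); last first.
  by rewrite !big_split/= -!mulr_suml law1 mul1r -!big_mkcond lawp lawq.
apply: eq_bigr => v _.
(* Only maps that actually occur move [i] by at most 1; all others have law 0. *)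
have [[w <-]|vN] := pselect (exists w, X w = v); last first.
  rewrite (_ : law v = 0) ?if_same ?mul0r ?addr0//.
  rewrite /map_law (_ : _ @^-1` _ = set0) ?measure0//.
  by apply/seteqP; split => // w /= wv; apply: vN; exists w.
rewrite /X ffunE; case: (updateP pi_gt0 i (U 0%N w)) => [_ _|_ _ i0|_ _].
- by rewrite eqxx gtn_eqF ?mul0r ?addr0 -?mulrDr 1?addrC ?subrK// ltnW.
- rewrite prednK// eqxx ltn_eqF ?mul0r ?addr0 -?mulrDr 1?addrC ?subrK//.
  by rewrite ltnS leq_pred.
- by rewrite ltn_eqF// gtn_eqF// !mul0r !addr0.
Qed.

(** Common form of both bounds: [x0] is the extreme starting state whose chain is followed, and [H]
    has to decrease only before coalescence. *)
Lemma coalescence_time_lyapunov (H : nat -> R) (x0 : 'I_N.+1) :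
  (forall i, 0 <= H i) ->
  (forall u n, let g := iter_map (update_map pi_) u n in
    nonconstant g ->
    p (g x0) * (H (g x0).+1 - H (g x0)) + q (g x0) * (H (g x0).-1 - H (g x0)) <= -1) ->
  (\int[P]_w coalescence_time pi_ (fun n => U n w) <= (H x0)%:E)%E.
Proof.
move=> H0 drift.
have lawU n (B : set R) : measurable B -> P (U n @^-1` B) = P (U 0%N @^-1` B).
  by move=> mB; have := uniformU n mB; have := uniformU 0 mB; rewrite /distribution/pushforward => -> ->.
(* Killed at coalescence, since [chain pi_ u x0] may leave its target state again. *)
pose f (g : {ffun 'I_N.+1 -> 'I_N.+1}) := if nonconstant g then H (g x0) else 0.
have f0 g : 0 <= f g by rewrite /f; case: ifP.
have fdrift u n : let g := iter_map (update_map pi_) u n in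
    \sum_v law v * f [ffun x => v (g x)] <= f g - (nonconstant g)%:R.
  move=> g; rewrite {2}/f; case: ifPn => gc; last first.
    (* A constant map stays constant under any further map, so [f] stays 0. *)
    rewrite subr0 big1// => v _; rewrite /f ifF ?mulr0//.
    apply/negbTE/constantP => k l; rewrite !ffunE; congr (v _).
    exact: (constantP _ gc).
  (* Lifting the killing can only raise the mean, because [H] is nonnegative. *)
  apply: (@le_trans _ _ (\sum_v law v * H (v (g x0)))).
    apply: ler_sum => v _; rewrite ler_wpM2l ?fine_ge0//.
    by rewrite /f; case: ifP => // _; rewrite ffunE.
  by rewrite update_map_generator -addrA lerD2l; exact: drift.
apply: (@le_trans _ _ (\int[P]_w \sum_(n <oo)
    (nonconstant (iter_map (update_map pi_) (fun i => U i w) n))%:R%:E)%E).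
  apply: ge0_le_integral_nonmeasurable => w; last exact: coalescence_time_le_series.
  by apply: le_ereal_inf_tmp => _ [n _ <-]; rewrite lee_fin ler0n.
apply: le_trans (integral_count_le (measurable_update_map pi_) indepU lawU f0 fdrift) _.
rewrite lee_fin /f; case: ifP => // _; by rewrite ffunE.
Qed.

(** * Partial masses and mean passage times *)

Definition mass_le (j : nat) : R := \sum_(m < N.+1 | (m <= j)%N) pi_ m.
Definition mass_gt (j : nat) : R := \sum_(m < N.+1 | (j < m)%N) pi_ m.

Lemma mass_leS j : (j < N)%N -> mass_le j.+1 = mass_le j + pi_ (inord j.+1).
Proof.
move=> jN; rewrite /mass_le (bigD1 (inord j.+1)) ?inordK//= addrC; congr (_ + _).
apply: eq_bigl => m; rewrite -val_eqE/= inordK//.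
by rewrite -[RHS]ltnS ltn_neqAle andbC.
Qed.

Lemma mass_gtS j : (j < N)%N -> mass_gt j = pi_ (inord j.+1) + mass_gt j.+1.
Proof.
move=> jN; rewrite /mass_gt (bigD1 (inord j.+1)) ?inordK//=; congr (_ + _).
apply: eq_bigl => m; rewrite -val_eqE/= inordK//.
by rewrite [RHS]ltn_neqAle eq_sym andbC.
Qed.

Lemma mass_le0 : mass_le 0 = pi_ (inord 0).
Proof.
rewrite /mass_le (big_pred1 (inord 0))// => m.
by rewrite /= leqn0 -val_eqE/= inordK.
Qed.

Lemma mass_gtN : mass_gt N = 0.
Proof. by rewrite /mass_gt big_pred0// => m; rewrite ltnNge -ltnS ltn_ord. Qed.

Definition up_time (j : nat) : R := 1 / p j * (mass_le j / pi_ (inord j)).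
(** For [j < N], the mean passage time from [j.+1] to [j]: detailed balance turns [pi_] times [q] at
    [j.+1] into [pi_] times [p] at [j]. *)
Definition down_time (j : nat) : R := 1 / p j * (mass_gt j / pi_ (inord j)).

Lemma up_time_ge0 j : 0 <= up_time j.
Proof.
rewrite /up_time mulr_ge0 ?divr_ge0 ?up_prob_ge0 ?(ltW (pi_gt0 _))//.
by apply: sumr_ge0 => m _; exact: ltW.
Qed.

Lemma down_time_ge0 j : 0 <= down_time j.
Proof.
rewrite /down_time mulr_ge0 ?divr_ge0 ?up_prob_ge0 ?(ltW (pi_gt0 _))//.
by apply: sumr_ge0 => m _; exact: ltW.
Qed.

Lemma up_prob_divK (x : R) j : (j < N)%N -> p j * (1 / p j * x) = x.
Proof. by move=> jN; rewrite mulrA div1r divff ?mul1r// gt_eqF// up_prob_gt0. Qed.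

(* Detailed balance [pi j * p j = pi j.+1 * q j.+1]. *)
Lemma down_prob_divK (x : R) j : (j < N)%N ->
  q j.+1 * (1 / p j * (x / pi_ (inord j))) = x / pi_ (inord j.+1).
Proof.
move=> jN; rewrite (down_probS pi_) // -mulrA up_prob_divK// /gamma mulrC mulrA.
by rewrite divfK// gt_eqF.
Qed.

(** The upward term is minus the mass up to [i] over [pi_ i], the downward term is the mass up to
    [i.-1] over [pi_ i]; they differ by the single mass at [i]. *)
Lemma up_time_drift i : (i < N)%N -> let H i := \sum_(i <= j < N) up_time j in
  p i * (H i.+1 - H i) + q i * (H i.-1 - H i) = -1.
Proof.
move=> iN H; have HS j : (j < N)%N -> H j = up_time j + H j.+1.
  by move=> jN; rewrite /H big_ltn.
rewrite [H i in X in X + _]HS// opprD addrCA subrr addr0 mulrN up_prob_divK//.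
(* At 0 there is no downward term, and the mass up to 0 is that of the state 0 itself. *)
case: i iN => [|i] iN /=.
  by rewrite mul0r addr0 mass_le0 divff// gt_eqF.
rewrite (HS i) 1?ltnW// addrK down_prob_divK 1?ltnW// mass_leS 1?ltnW//.
by rewrite mulrDl opprD divff ?gt_eqF// addrAC addNr add0r.
Qed.

Lemma down_time_drift i : (0 < i)%N -> (i <= N)%N ->
  let H i := \sum_(j < i) down_time j in
  p i * (H i.+1 - H i) + q i * (H i.-1 - H i) = -1.
Proof.
case: i => // i _ iN H /=.
have HS j : H j.+1 = H j + down_time j by rewrite /H big_ord_recr.
rewrite (HS i.+1) addrAC subrr add0r (HS i) opprD addrA subrr add0r mulrN.
rewrite down_prob_divK// mass_gtS// mulrDl divff ?gt_eqF//.
suff -> : p i.+1 * down_time i.+1 = mass_gt i.+1 / pi_ (inord i.+1).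
  by rewrite opprD addrCA subrr addr0.
(* At the top state [p] is 0 and cannot be cancelled, but the mass above it is 0 too. *)
move: iN; rewrite leq_eqVlt => /predU1P[iE|iN]; last exact: up_prob_divK.
by rewrite iE up_probN mass_gtN !mul0r.
Qed.

Lemma sum_le_bigmax (a : nat -> R) (b : 'I_N.+1 -> R) :
  (forall i : 'I_N.+1, (i < N)%N -> a i = b i) ->
  \sum_(j < N) a j <= \big[Num.max/0]_(i < N.+1 | (i < N)%N) b i * N%:R.
Proof.
move=> ab; rewrite mulr_natr -[X in _ *+ X](card_ord N) -sumr_const.
apply: ler_sum => j _.
have jN : (widen_ord (leqnSn N) j < N)%N by rewrite /= ltn_ord.
by apply: le_trans (le_bigmax_cond _ _ jN); rewrite -ab.
Qed.

(** * The two bounds and their minimum *)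

Lemma coalescence_time_up :
  (\int[P]_w coalescence_time pi_ (fun n => U n w) <= (\sum_(j < N) up_time j)%:E)%E.
Proof.
rewrite -(big_mkord xpredT up_time).
apply: (@coalescence_time_lyapunov (fun i => \sum_(i <= j < N) up_time j) ord0).
  by move=> i; apply: sumr_ge0 => j _; exact: up_time_ge0.
by move=> u n g gc; rewrite up_time_drift//; exact: nonconstant_ord0.
Qed.

Lemma coalescence_time_down :
  (\int[P]_w coalescence_time pi_ (fun n => U n w) <= (\sum_(j < N) down_time j)%:E)%E.
Proof.
apply: (@coalescence_time_lyapunov (fun i => \sum_(j < i) down_time j) ord_max).
  by move=> i; apply: sumr_ge0 => j _; exact: down_time_ge0.
move=> u n g gc; rewrite down_time_drift//; last by rewrite -ltnS.
exact: nonconstant_ord_max.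
Qed.

End Coalescence.

Theorem theorem2p3 (R : realType) (N : nat) (pi_ : 'I_N.+1 -> R)
    (d : measure_display) (T : measurableType d) (P : probability T R)
    (U : nat -> {RV P >-> R}) :
  (0 < N)%N ->
  positive_distribution pi_ ->
  mutually_independent U ->
  (forall n, uniform01 (U n)) ->
  (\int[P]_w coalescence_time pi_ (fun n => U n w)
     <= (theta pi_ * N%:R)%:E)%E.
Proof.
(* Both bounds hold, so whichever maximum is the smaller one can be used. *)
move=> N0 [pi0 _] indepU uniU; rewrite /theta minEle; case: ifP => _.
  apply: le_trans (coalescence_time_up pi0 N0 indepU uniU) _.
  rewrite lee_fin; apply: sum_le_bigmax => i _.
  by rewrite /up_time /mass_le inord_val mulr_suml.
apply: le_trans (coalescence_time_down pi0 N0 indepU uniU) _.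
rewrite lee_fin; apply: sum_le_bigmax => i _.
by rewrite /down_time /mass_gt inord_val mulr_suml.
Qed.
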